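(* The covariant functor $H:\mathbf{SP}\to\mathbf{L}_0$ restricts to a functor $H:\mathbf{SP}_0\to\mathbf{L}_0$, and the covariant functor $K:\mathbf{L}_0\to\mathbf{SP}$ corestricts to a functor $K:\mathbf{L}_0\to\mathbf{SP}_0$. These functors establish an equivalence of categories between $\mathbf{SP}_0$ and $\mathbf{L}_0$. Moreover, $H\circ K=\mathrm{Id}_{\mathbf{L}_0}$.
   Context: All orders written $<$ are reflexive (non-strict). A state property system $(\Sigma,\mathcal L,\xi)$ consists of a pre-ordered set $(\Sigma,<)$, a complete lattice $(\mathcal L,<,\wedge,\vee)$ with maximal element $I$ and minimal element $0$, and a function $\xi:\Sigma\to\mathcal P(\mathcal L)$ such that for all $p\in\Sigma$ and all families $(a_i)_i$ in $\mathcal L$: $I\in\xi(p)$; $0\notin\xi(p)$; ($a_i\in\xi(p)$ for all $i$) $\Leftrightarrow$ $\wedge_i a_i\in\xi(p)$; and for $p,q\in\Sigma$, $a,b\in\mathcal L$: $p<q\Leftrightarrow\xi(q)\subset\xi(p)$; $a<b\Leftrightarrow$ (for all $r\in\Sigma$, $a\in\xi(r)$ implies $b\in\xi(r)$). A morphism $(m,n):(\Sigma',\mathcal L',\xi')\to(\Sigma,\mathcal L,\xi)$ of state property systems is a pair of functions $m:\Sigma'\to\Sigma$, $n:\mathcal L\to\mathcal L'$ such that for all $a\in\mathcal L$, $p'\in\Sigma'$: $a\in\xi(m(p'))\Leftrightarrow n(a)\in\xi'(p')$. Composition is $(m_2,n_2)\circ(m_1,n_1)=(m_2\circ m_1,n_1\circ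 n_2)$, with identities $(\mathrm{id}_\Sigma,\mathrm{id}_{\mathcal L})$. This is the category $\mathbf{SP}$. $\mathbf{SP}_0$ is the full subcategory of $\mathbf{SP}$ of state determined state property systems, i.e. those with $\xi$ injective. A based complete lattice $(\Sigma,\mathcal L)$ is a complete lattice $\mathcal L$ with a subset $\Sigma\subset\mathcal L$, $0\notin\Sigma$, that is order-generating: $a=\bigvee\{x\in\Sigma\mid x<a\}$ for every $a\in\mathcal L$. A morphism of based complete lattices $f:(\Sigma,\mathcal L)\to(\Sigma',\mathcal L')$ is a function $f:\mathcal L\to\mathcal L'$ with $f(\Sigma)\subset\Sigma'$ and $f(\vee_ia_i)=\vee_if(a_i)$ for all families $(a_i)_i$ in $\mathcal L$; composition is composition of functions. This is the category $\mathbf{L}_0$. The functor $H$: for a state property system put $s_\xi:\Sigma\to\mathcal L$, $s_\xi(p)=\bigwedge\xi(p)$, and $\Sigma^\xi=s_\xi(\Sigma)$; then $H(\Sigma,\mathcal L,\xi)=(\Sigma^\xi,\mathcal L)$, and for a morphism $(m,n):(\Sigma',\mathcal L',\xi')\to(\Sigma,\mathcal L,\xi)$, $H(m,n)=n_*:\mathcal L'\to\mathcal L$, $n_*(a')=\bigwedge\{a\in\mathcal L\mid a'<n(a)\}$ (the lower adjoint of $n$). The functor $K$: $K(\Sigma,\mathcal L)=(\Sigma,\mathcal L,\xi)$ where $\Sigma$ carries the order induced from $\mathcal L$ and $\xi(p)=[p,I]=\{a\in\mathcal L\mid p<a\}$; for a morphism $f:(\Sigma',\mathcal L')\to(\Sigma,\mathcal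 L)$, $K(f)=(f|_{\Sigma'}^{\Sigma},f^* )$, where $f|_{\Sigma'}^{\Sigma}:\Sigma'\to\Sigma$ is the restriction and corestriction of $f$ and $f^*:\mathcal L\to\mathcal L'$, $f^*(a)=\bigvee\{a'\in\mathcal L'\mid f(a')<a\}$ (the upper adjoint of $f$). *)

(* Defs.v *)
From HB Require Import structures.
From mathcomp Require Import all_boot all_order.
From mathcomp Require Import boolp classical_sets.

Set Implicit Arguments.
Unset Strict Implicit.
Unset Printing Implicit Defensive.
#[local] Obligation Tactic := idtac.

Import Order.TTheory.
Local Open Scope order_scope.
Local Open Scope classical_set_scope.

Record category := Category {
  obj :> Type;
  hom : obj -> obj -> Type;
  idm : forall x, hom x x;
  compm : forall x y z, hom y z -> hom x y -> hom x z;
  compm1f : forall x y (f : hom x y), compm (idm y) f = f;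
  compmf1 : forall x y (f : hom x y), compm f (idm x) = f;
  compmA : forall x y z t (h : hom z t) (g : hom y z) (f : hom x y),
    compm h (compm g f) = compm (compm h g) f }.

Arguments idm {c} x.

Record functor (C D : category) := Functor {
  fobj :> C -> D;
  fmap : forall x y, hom x y -> hom (fobj x) (fobj y);
  fmap_id : forall x, fmap (idm x) = idm (fobj x);
  fmap_comp : forall x y z (g : hom y z) (f : hom x y),
    fmap (compm g f) = compm (fmap g) (fmap f) }.

Program Definition functor_id (C : category) : functor C C :=
  @Functor C C (fun x => x) (fun x y f => f) _ _.
Next Obligation. by move=> *. Qed.
Next Obligation. by move=> *. Qed.

Program Definition functor_comp (C D E : category)
    (G : functor D E) (F : functor C D) : functor C E :=
  @Functor C E (fun x => G (F x)) (fun x y f => fmap G (fmap F f)) _ _.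
Next Obligation. by move=> C D E G F x /=; rewrite !fmap_id. Qed.
Next Obligation. by move=> C D E G F x y z g f /=; rewrite !fmap_comp. Qed.

Program Definition full_subcategory (C : category) (P : C -> Prop) : category :=
  @Category {x : C | P x} (fun x y => hom (sval x) (sval y))
    (fun x => idm (sval x)) (fun x y z g f => compm g f) _ _ _.
Next Obligation. by move=> *; apply: compm1f. Qed.
Next Obligation. by move=> *; apply: compmf1. Qed.
Next Obligation. by move=> *; apply: compmA. Qed.

Program Definition inclusion (C : category) (P : C -> Prop) :
    functor (full_subcategory P) C :=
  @Functor (full_subcategory P) C (fun x => sval x) (fun x y f => f) _ _.
Next Obligation. by move=> *. Qed.
Next Obligation. by move=> *. Qed.

Definition is_iso (C : category) (x y : C) (f : hom x y) : Prop :=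
  exists g : hom y x, compm g f = idm x /\ compm f g = idm y.

Definition naturally_isomorphic (C D : category) (F G : functor C D) : Prop :=
  exists eta : forall x, hom (F x) (G x),
    (forall x y (f : hom x y),
       compm (eta y) (fmap F f) = compm (fmap G f) (eta x)) /\
    (forall x, is_iso (eta x)).

Definition equivalence_of_categories (C D : category)
    (F : functor C D) (G : functor D C) : Prop :=
  naturally_isomorphic (functor_id C) (functor_comp G F) /\
  naturally_isomorphic (functor_comp F G) (functor_id D).

HB.mixin Record TBLattice_isComplete d L of Order.TBLattice d L := {
  bigmeet : set L -> L;
  bigjoin : set L -> L;
  bigmeetP : forall A, infimums A (bigmeet A);
  bigjoinP : forall A, supremums A (bigjoin A) }.

#[short(type="completeLatticeType")]
HB.structure Definition CompleteLattice d :=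
  { L of Order.TBLattice d L & TBLattice_isComplete d L }.

Section CompleteLatticeTheory.
Context {d : Order.disp_t} {L : completeLatticeType d}.
Implicit Types (A : set L) (a b : L).

Lemma bigmeet_le A a : A a -> bigmeet A <= a.
Proof. by have [+ _] := bigmeetP A; apply. Qed.

Lemma le_bigmeet A b : (forall a, A a -> b <= a) -> b <= bigmeet A.
Proof. by have [_ +] := bigmeetP A; apply. Qed.

Lemma bigjoin_ge A a : A a -> a <= bigjoin A.
Proof. by have [+ _] := bigjoinP A; apply. Qed.

Lemma bigjoin_le A b : (forall a, A a -> a <= b) -> bigjoin A <= b.
Proof. by have [_ +] := bigjoinP A; apply. Qed.

End CompleteLatticeTheory.

Section Adjoints.
Context {d : Order.disp_t} {L' L : completeLatticeType d}.

Definition lower_adjoint (n : L -> L') (a' : L') : L :=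
  bigmeet [set a | a' <= n a].

Definition upper_adjoint (f : L' -> L) (a : L) : L' :=
  bigjoin [set a' | f a' <= a].

Lemma lower_adjointP (n : L -> L') :
  (forall A, n (bigmeet A) = bigmeet (n @` A)) ->
  forall a a', (lower_adjoint n a' <= a) = (a' <= n a).
Proof.
move=> nM a a'; have nmono x y : x <= y -> n x <= n y.
  move=> xy; have -> : x = bigmeet [set x; y].
    apply/le_anti/andP; split; last by apply: bigmeet_le; left.
    by apply: le_bigmeet => _ [] ->.
  by rewrite nM; apply: bigmeet_le; exists y => //; right.
apply/idP/idP => [/nmono|]; last exact: bigmeet_le.
by apply: le_trans; rewrite nM; apply: le_bigmeet => _ [b /= ab <-].
Qed.

Lemma upper_adjointP (f : L' -> L) :
  (forall A, f (bigjoin A) = bigjoin (f @` A)) ->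
  forall a a', (f a' <= a) = (a' <= upper_adjoint f a).
Proof.
move=> fJ a a'; have fmono x y : x <= y -> f x <= f y.
  move=> xy; have -> : y = bigjoin [set x; y].
    apply/le_anti/andP; split; first by apply: bigjoin_ge; right.
    by apply: bigjoin_le => _ [] ->.
  by rewrite fJ; apply: bigjoin_ge; exists x => //; left.
apply/idP/idP => [|/fmono]; first exact: bigjoin_ge.
by move/le_trans; apply; rewrite fJ; apply: bigjoin_le => _ [b /= ab <-].
Qed.

End Adjoints.

(* A family of properties enters only through its set of members.  A display is
   a notational tag, so using one for all orders is no restriction. *)
Record state_property_system (d : Order.disp_t) := StatePropertySystem {
  states : preorderType d;
  props : completeLatticeType d;
  xi : states -> set props;
  xi_top : forall p, xi p \top;
  xi_bot : forall p, ~ xi p \bot;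
  xi_bigmeet : forall p (A : set props),
    (forall a, A a -> xi p a) <-> xi p (bigmeet A);
  xi_states : forall p q, p <= q <-> xi q `<=` xi p;
  xi_props : forall a b, a <= b <-> (forall r, xi r a -> xi r b) }.

Arguments xi {d s} p.

Record sp_morphism d (X' X : state_property_system d) := SPMorphism {
  mor_states : states X' -> states X;
  mor_props : props X -> props X';
  mor_xi : forall a p', xi (mor_states p') a <-> xi p' (mor_props a) }.

Lemma sp_morphism_eq d (X' X : state_property_system d)
    (f g : sp_morphism X' X) :
  mor_states f =1 mor_states g -> mor_props f =1 mor_props g -> f = g.
Proof.
case: f g => [m n mn] [m' n' mn'] /= /funext em /funext en.
by case: m' / em mn' => mn'; case: n' / en mn' => mn'; congr SPMorphism.
Qed.

Program Definition sp_id d (X : state_property_system d) : sp_morphism X X :=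
  @SPMorphism d X X (fun p => p) (fun a => a) _.
Next Obligation. by move=> *. Qed.

Program Definition sp_comp d (X Y Z : state_property_system d)
    (g : sp_morphism Y Z) (f : sp_morphism X Y) : sp_morphism X Z :=
  @SPMorphism d X Z (mor_states g \o mor_states f)
    (mor_props f \o mor_props g) _.
Next Obligation. by move=> d X Y Z g f a p /=; rewrite mor_xi mor_xi. Qed.

Program Definition SP (d : Order.disp_t) : category :=
  @Category (state_property_system d) (@sp_morphism d) (@sp_id d) (@sp_comp d)
    _ _ _.
Next Obligation. by move=> *; exact: sp_morphism_eq. Qed.
Next Obligation. by move=> *; exact: sp_morphism_eq. Qed.
Next Obligation. by move=> *; exact: sp_morphism_eq. Qed.

Definition state_determined d (X : state_property_system d) : Prop :=
  injective (@xi d X).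

Definition SP0 (d : Order.disp_t) : category :=
  full_subcategory (C := SP d) (@state_determined d).

Definition SP0_inclusion (d : Order.disp_t) : functor (SP0 d) (SP d) :=
  inclusion (C := SP d) (@state_determined d).

Record based_complete_lattice (d : Order.disp_t) := BasedCompleteLattice {
  lat : completeLatticeType d;
  base : set lat;
  base_bot : ~ base \bot;
  base_gen : forall a, a = bigjoin [set x | base x /\ x <= a] }.

Arguments base {d} b.

Record bl_morphism d (X Y : based_complete_lattice d) := BLMorphism {
  bl_fun :> lat X -> lat Y;
  bl_base : bl_fun @` base X `<=` base Y;
  bl_bigjoin : forall A : set (lat X),
    bl_fun (bigjoin A) = bigjoin (bl_fun @` A) }.

Lemma bl_morphism_eq d (X Y : based_complete_lattice d)
    (f g : bl_morphism X Y) : f =1 g -> f = g.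
Proof.
case: f g => [f fb fj] [g gb gj] /= /funext e.
by case: g / e gb gj => gb gj; congr BLMorphism.
Qed.

Program Definition bl_id d (X : based_complete_lattice d) : bl_morphism X X :=
  @BLMorphism d X X (fun a => a) _ _.
Next Obligation. by move=> d X; rewrite image_id. Qed.
Next Obligation. by move=> d X A /=; rewrite image_id. Qed.

Program Definition bl_comp d (X Y Z : based_complete_lattice d)
    (g : bl_morphism Y Z) (f : bl_morphism X Y) : bl_morphism X Z :=
  @BLMorphism d X Z (g \o f) _ _.
Next Obligation.
move=> d X Y Z g f _ [x Xx <-] /=; apply: bl_base; exists (f x) => //.
by apply: bl_base; exists x.
Qed.
Next Obligation. by move=> d X Y Z g f A /=; rewrite !bl_bigjoin image_comp. Qed.

Program Definition L0 (d : Order.disp_t) : category :=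
  @Category (based_complete_lattice d) (@bl_morphism d) (@bl_id d) (@bl_comp d)
    _ _ _.
Next Obligation. by move=> *; exact: bl_morphism_eq. Qed.
Next Obligation. by move=> *; exact: bl_morphism_eq. Qed.
Next Obligation. by move=> *; exact: bl_morphism_eq. Qed.

Section FunctorH.
Context {d : Order.disp_t}.
Implicit Types X Y : state_property_system d.

Definition s_xi X (p : states X) : props X := bigmeet (xi p).

Lemma s_xi_le X (p : states X) a : s_xi p <= a <-> xi p a.
Proof.
split => [|]; last exact: bigmeet_le.
by move/xi_props; apply; apply/xi_bigmeet.
Qed.

Lemma mor_props_bigmeet X' X (f : sp_morphism X' X) (A : set (props X)) :
  mor_props f (bigmeet A) = bigmeet (mor_props f @` A).
Proof.
have H r : xi r (mor_props f (bigmeet A)) <->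
           xi r (bigmeet (mor_props f @` A)).
  rewrite -mor_xi -!xi_bigmeet; split=> [h _ [a Aa <-]|h a Aa].
    by rewrite -mor_xi; apply: h.
  by rewrite mor_xi; apply: h; exists a.
by apply/le_anti/andP; split; apply/xi_props => r /H.
Qed.

Program Definition H_obj X : based_complete_lattice d :=
  @BasedCompleteLattice d (props X) (range (@s_xi X)) _ _.
Next Obligation. by move=> X [p _ e]; apply: (@xi_bot d X p); apply/s_xi_le; rewrite e. Qed.
Next Obligation.
move=> X a; apply/le_anti/andP; split; last by apply: bigjoin_le => x [].
apply/xi_props => r /s_xi_le ra; apply/s_xi_le; apply: bigjoin_ge.
by split=> //; exists r.
Qed.

Program Definition H_mor X' X (f : sp_morphism X' X) :
    bl_morphism (H_obj X') (H_obj X) :=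
  @BLMorphism d (H_obj X') (H_obj X) (lower_adjoint (mor_props f)) _ _.
Next Obligation.
move=> X' X f _ [_ [p' _ <-] <-]; exists (mor_states f p') => //=.
have adj := lower_adjointP (mor_props_bigmeet f).
have E a : (s_xi (mor_states f p') <= a) =
           (lower_adjoint (mor_props f) (s_xi p') <= a).
  by rewrite adj; apply/idP/idP => /s_xi_le/mor_xi/s_xi_le.
by apply/le_anti; rewrite E lexx -E lexx.
Qed.
Next Obligation.
move=> X' X f A /=; have adj := lower_adjointP (mor_props_bigmeet f).
apply/le_anti/andP; split.
  rewrite adj; apply: bigjoin_le => a Aa; rewrite -adj.
  by apply: bigjoin_ge; exists a.
apply: bigjoin_le => _ [a Aa <-]; rewrite adj.
by apply: (@le_trans _ _ (bigjoin A)); [apply: bigjoin_ge | rewrite -adj].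
Qed.

End FunctorH.

Program Definition H (d : Order.disp_t) : functor (SP d) (L0 d) :=
  @Functor (SP d) (L0 d) (@H_obj d) (@H_mor d) _ _.
Next Obligation.
move=> d X; apply: bl_morphism_eq => a /=; apply/le_anti/andP; split.
  by apply: bigmeet_le => /=; exact: lexx.
by apply: le_bigmeet.
Qed.
Next Obligation.
move=> d X Y Z g f; apply: bl_morphism_eq => a /=.
have adjf := lower_adjointP (mor_props_bigmeet f).
have adjg := lower_adjointP (mor_props_bigmeet g).
have adjc := lower_adjointP (mor_props_bigmeet (sp_comp g f)).
have E b : (lower_adjoint (mor_props (sp_comp g f)) a <= b) =
  (lower_adjoint (mor_props g) (lower_adjoint (mor_props f) a) <= b).
  by rewrite adjc adjg adjf.
by apply/le_anti; rewrite E lexx -E lexx.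
Qed.

Section FunctorK.
Context {d : Order.disp_t}.
Implicit Types X Y : based_complete_lattice d.

Definition base_type X : Type := {x : lat X | x \in base X}.

HB.instance Definition _ X := SubChoice.on (base_type X).
HB.instance Definition _ X :=
  [SubChoice_isSubPOrder of base_type X by <: with d].

Program Definition K_obj X : state_property_system d :=
  @StatePropertySystem d (base_type X) (lat X)
    (fun p => [set a | val p <= a]) _ _ _ _ _.
Next Obligation. by move=> X p /=; rewrite lex1. Qed.
Next Obligation.
move=> X p /=; rewrite lex0 => /eqP e; apply: (@base_bot d X).
by rewrite -e; apply/set_mem/(valP p).
Qed.
Next Obligation.
move=> X p A /=; split=> [|pA a Aa]; first exact: le_bigmeet.
by apply: le_trans pA _; apply: bigmeet_le.
Qed.
Next Obligation.
move=> X p q /=; rewrite -[p <= q]Order.le_val; split=> [pq a|]; first exact: le_trans pq.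
by move=> h; apply: (h (val q)) => /=; exact: lexx.
Qed.
Next Obligation.
move=> X a b; split=> [ab r /= ra|ab]; first exact: le_trans ab.
rewrite (base_gen a); apply: bigjoin_le => x [Xx xa].
exact: (ab (exist _ x (mem_set Xx))).
Qed.

Definition K_states X' X (f : bl_morphism X' X) (p : base_type X') :
    base_type X :=
  exist _ (f (val p))
    (mem_set (bl_base (imageP f (set_mem (valP p))))).

Program Definition K_mor X' X (f : bl_morphism X' X) :
    sp_morphism (K_obj X') (K_obj X) :=
  @SPMorphism d (K_obj X') (K_obj X) (K_states f) (upper_adjoint f) _.
Next Obligation.
by move=> X' X f a p /=; rewrite (upper_adjointP (bl_bigjoin f)).
Qed.

End FunctorK.

Program Definition K (d : Order.disp_t) : functor (L0 d) (SP d) :=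
  @Functor (L0 d) (SP d) (@K_obj d) (@K_mor d) _ _.
Next Obligation.
move=> d X; apply: sp_morphism_eq => [p|a] /=; first exact: val_inj.
apply/le_anti/andP; split; first exact: bigjoin_le.
by apply: bigjoin_ge => /=; exact: lexx.
Qed.
Next Obligation.
move=> d X Y Z g f; apply: sp_morphism_eq => [p|a] /=; first exact: val_inj.
have adjf := upper_adjointP (bl_bigjoin f).
have adjg := upper_adjointP (bl_bigjoin g).
have adjc := upper_adjointP (bl_bigjoin (bl_comp g f)).
have E b : (b <= upper_adjoint (bl_comp g f) a) =
  (b <= upper_adjoint f (upper_adjoint g a)).
  by rewrite -adjc -adjf -adjg.
by apply/le_anti; rewrite -E lexx E lexx.
Qed.

(* Main.v *)
(* The heart of the matter is that [xi p] is the principal filter of [s_xi p].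
   Hence [s_xi] is injective exactly when the system is state determined, and
   then [(s_xi, id)] is an isomorphism from [X] onto [K (H X)].  Conversely
   the filter of [x] has infimum [x], so that [H (K X)] has the same base as
   [X], and taking the upper and then the lower adjoint of a join-preserving
   map gives it back. *)
Require Import Defs.
From mathcomp Require Import all_boot all_order.
From mathcomp Require Import boolp classical_sets.

Set Implicit Arguments.
Unset Strict Implicit.
Unset Printing Implicit Defensive.

Import Order.TTheory.
Local Open Scope order_scope.
Local Open Scope classical_set_scope.

(** Equality of functors compares morphisms whose endpoints are only propositionally equal, hence
    the transport. *)
Definition hom_cast (C : category) (x x' y y' : C) (ex : x = x') (ey : y = y')
    (f : hom x y) : hom x' y' :=
  ecast z (hom x' z) ey (ecast z (hom z y) ex f).

Lemma functor_eq (C D : category) (F G : functor C D)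
    (e : forall x, F x = G x) :
  (forall x y (f : hom x y), hom_cast (e x) (e y) (fmap F f) = fmap G f) ->
  F = G.
Proof.
case: F G e => [F0 F1 Fi Fc] [G0 G1 Gi Gc] /= e.
have /funext E := e; case: G0 / E G1 Gi Gc e => G1 Gi Gc e h.
have E : F1 = G1.
  apply/functional_extensionality_dep => x.
  apply/functional_extensionality_dep => y; apply/funext => f.
  by rewrite -h (Prop_irrelevance (e x) erefl) (Prop_irrelevance (e y) erefl).
by case: G1 / E Gi Gc h => Gi Gc _; congr Functor; exact: Prop_irrelevance.
Qed.

Lemma naturally_isomorphic_refl (C D : category) (F : functor C D) :
  naturally_isomorphic F F.
Proof.
exists (fun x => idm (F x)); split=> [x y f|x]; first by rewrite compm1f compmf1.
by exists (idm (F x)); rewrite compm1f.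
Qed.

Section BasedCompleteLattices.
Context {d : Order.disp_t}.

Lemma based_complete_lattice_eq (L : completeLatticeType d) (B B' : set L)
    b0 bg b0' bg' :
  B = B' ->
  BasedCompleteLattice (base := B) b0 bg =
  BasedCompleteLattice (base := B') b0' bg'.
Proof.
move=> E; case: B' / E b0' bg' => b0' bg'.
by congr BasedCompleteLattice; exact: Prop_irrelevance.
Qed.

(** When the lattices agree on the nose and only the bases vary, the transport changes proofs but
    not the underlying function: eliminating the equalities of bases turns both casts into casts
    along [erefl]. *)
Lemma hom_castE (L M : completeLatticeType d) (B B' : set L) (A A' : set M)
    b0 bg b0' bg' a0 ag a0' ag'
    (eB : BasedCompleteLattice (base := B) b0 bg =
          BasedCompleteLattice (base := B') b0' bg' :> L0 d)
    (eA : BasedCompleteLattice (base := A) a0 ag =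
          BasedCompleteLattice (base := A') a0' ag' :> L0 d)
    (f : hom (BasedCompleteLattice b0 bg : L0 d) (BasedCompleteLattice a0 ag))
    (x : L) :
  B = B' -> A = A' -> bl_fun (hom_cast eB eA f) x = bl_fun f x.
Proof.
move=> E F; case: B' / E b0' bg' eB => b0' bg'.
case: A' / F a0' ag' eA => a0' ag'.
rewrite (Prop_irrelevance b0' b0) (Prop_irrelevance bg' bg).
rewrite (Prop_irrelevance a0' a0) (Prop_irrelevance ag' ag) => eA eB.
by rewrite (Prop_irrelevance eB erefl) (Prop_irrelevance eA erefl).
Qed.

Lemma s_xi_K (X : based_complete_lattice d) (p : states (K_obj X)) :
  s_xi p = val p.
Proof.
apply/le_anti/andP; split; first by apply: bigmeet_le => /=; exact: lexx.
by apply: le_bigmeet.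
Qed.

Lemma base_HK (X : based_complete_lattice d) : base (H_obj (K_obj X)) = base X.
Proof.
apply/seteqP; split=> [_ [p _ <-]|x Xx].
  by rewrite s_xi_K; exact/set_mem/(valP p).
by exists (exist _ x (mem_set Xx)) => //; rewrite s_xi_K.
Qed.

Lemma HK_obj (X : based_complete_lattice d) : H_obj (K_obj X) = X.
Proof.
by case: X (base_HK X) => L B b0 bg; apply: based_complete_lattice_eq.
Qed.

(** By adjunction, the set whose infimum is taken consists of the [b] above [f a]. *)
Lemma lower_upper_adjoint (X Y : based_complete_lattice d)
    (f : bl_morphism X Y) : lower_adjoint (upper_adjoint f) =1 f.
Proof.
move=> a; have adj := upper_adjointP (bl_bigjoin f).
apply/le_anti/andP; split; first by apply: bigmeet_le; rewrite /= -adj.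
by apply: le_bigmeet => b /=; rewrite -adj.
Qed.

Lemma HK_id : functor_comp (H d) (K d) = functor_id (L0 d).
Proof.
apply: (@functor_eq _ _ (functor_comp (H d) (K d)) (functor_id (L0 d)) HK_obj).
move=> X Y f; apply: bl_morphism_eq => a.
(* Once [X] and [Y] are destructed, both ends of each cast are visibly built on the same lattice, as
   [hom_castE] requires. *)
case: X Y f a (HK_obj X) (HK_obj Y) (base_HK X) (base_HK Y)
  => [L B b0 bg] [M A a0 ag] f x eX eY EX EY.
by rewrite (hom_castE eX eY _ x EX EY); exact: lower_upper_adjoint.
Qed.

End BasedCompleteLattices.

Section StateDetermined.
Context {d : Order.disp_t}.
Implicit Types (X Y : state_property_system d).

Lemma s_xi_inj X : state_determined X -> injective (@s_xi d X).
Proof.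
move=> detX p q e; apply: detX; apply/seteqP.
by split=> a /s_xi_le; [rewrite e | rewrite -e] => /s_xi_le.
Qed.

Lemma K_state_determined (X : based_complete_lattice d) :
  state_determined (K_obj X).
Proof. by move=> p q e; apply: val_inj; rewrite -!s_xi_K /s_xi e. Qed.

(** Both sides lie below the same properties [a], by adjunction and the defining condition of a
    morphism. This is naturality of the unit on states. *)
Lemma lower_adjoint_s_xi X Y (f : sp_morphism X Y) p :
  lower_adjoint (mor_props f) (s_xi p) = s_xi (mor_states f p).
Proof.
have adj := lower_adjointP (mor_props_bigmeet f).
apply/le_anti/andP; split; first by rewrite adj; apply/s_xi_le/mor_xi/s_xi_le.
by apply/s_xi_le/mor_xi/s_xi_le; rewrite -adj.
Qed.

(** This is naturality of the unit on properties: by adjunction, the join is over all [b] below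
    [mor_props f a]. *)
Lemma upper_lower_adjoint X Y (f : sp_morphism X Y) :
  upper_adjoint (lower_adjoint (mor_props f)) =1 mor_props f.
Proof.
move=> a; have adj := lower_adjointP (mor_props_bigmeet f).
apply/le_anti/andP; split; first by apply: bigjoin_le => b /=; rewrite adj.
by apply: bigjoin_ge; rewrite /= adj.
Qed.

Definition unit_states X (p : states X) : states (K_obj (H_obj X)) :=
  exist _ (s_xi p) (mem_set (imageT (@s_xi d X) p)).

Lemma unit_xi X (a : props X) p : xi (unit_states p) a <-> xi p a.
Proof. exact: s_xi_le. Qed.

Definition unit_mor X : sp_morphism X (K_obj (H_obj X)) :=
  @SPMorphism d X (K_obj (H_obj X)) (@unit_states X) id (@unit_xi X).

Lemma unit_natural X Y (f : sp_morphism X Y) :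
  sp_comp (unit_mor Y) f = sp_comp (K_mor (H_mor f)) (unit_mor X).
Proof.
apply: sp_morphism_eq => [p|a] /=; last by rewrite upper_lower_adjoint.
by apply: val_inj; rewrite /= lower_adjoint_s_xi.
Qed.

Lemma unit_is_iso X : state_determined X ->
  is_iso (C := SP d) (x := X) (unit_mor X).
Proof.
move=> detX.
have surj (x : states (K_obj (H_obj X))) : exists p, unit_states p = x.
  by have [p _ e] := set_mem (valP x); exists p; exact: val_inj.
(* The base of [H_obj X] is the range of [s_xi], so choice provides a right inverse of
   [unit_states]. *)
pose m x := sval (cid (surj x)).
have mK x : unit_states (m x) = x by rewrite /m; case: cid.
have m_xi (a : props X) x : xi (m x) a <-> xi x a.
  by rewrite -[in X in _ <-> X](mK x) unit_xi.
exists (@SPMorphism d (K_obj (H_obj X)) X m id m_xi).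
split; apply: sp_morphism_eq => // p /=.
(* State determination makes the chosen preimage of [unit_states p] equal to [p]. *)
by apply: (s_xi_inj detX); exact: (congr1 val (mK (unit_states p))).
Qed.

End StateDetermined.

Definition H0 (d : Order.disp_t) : functor (SP0 d) (L0 d) :=
  functor_comp (H d) (SP0_inclusion d).

Definition K0 (d : Order.disp_t) : functor (L0 d) (SP0 d) :=
  @Functor (L0 d) (SP0 d)
    (fun X => exist _ (K_obj X) (@K_state_determined d X)) (@K_mor d)
    (@fmap_id _ _ (K d)) (@fmap_comp _ _ (K d)).

Theorem theorem16 (d : Order.disp_t) :
  exists (H0 : functor (SP0 d) (L0 d)) (K0 : functor (L0 d) (SP0 d)),
    [/\ H0 = functor_comp (H d) (SP0_inclusion d),
        functor_comp (SP0_inclusion d) K0 = K d,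
        equivalence_of_categories H0 K0,
        functor_comp H0 K0 = functor_id (L0 d)
      & functor_comp (H d) (K d) = functor_id (L0 d)].
Proof.
have HK0 : functor_comp (H0 d) (K0 d) = functor_id (L0 d).
  (* The object and morphism parts are convertible; only the proofs of the functor laws differ. *)
  by rewrite -HK_id; congr Functor; exact: Prop_irrelevance.
exists (H0 d), (K0 d); split=> //; last exact: HK_id.
  by congr Functor; exact: Prop_irrelevance.
(* On the side of [L0] the natural isomorphism is an identity, since [HK0] is a strict equality. *)
split; last by rewrite HK0; exact: naturally_isomorphic_refl.
exists (fun X : SP0 d => unit_mor (sval X)); split=> [X Y f|X].
  exact: unit_natural.
exact: (unit_is_iso (svalP X)).
Qed.
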